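(* Let $\mathcal{M}$ be a confounded ANM with Gaussian noise with $n$ treatments, and suppose that $d_{\max}$ is greater than or equal to the maximum degree in the observable graph of the ANM. Then algorithm LearnObservableGraph, run with parameters $\alpha$ and $d_{\max}$, requires a maximum of $8\alpha\, d_{\max}\,(\log n)^2$ interventions to learn the true observable graph with probability at least $1-\frac{1}{n^{\alpha-2}}$. The algorithm also returns the required interventional data sets to compute the noise covariance matrix and the ACEs with success probability at least $1-\frac{1}{n^{\alpha-1}}$.
   Context: Setting. The SCM $\mathcal{M}$ has observed variables $\mathbf{V}=\{\mathbf{X},Y\}$ with treatments $\mathbf{X}=\{X_1,\dots,X_n\}$ and outcome $Y$, structural equations $X_i=f_i(Pa(X_i))+U_i$, $Y=f_Y(\mathbf{X})+U_Y$, and jointly Gaussian, possibly correlated noise $\mathbf{U}=(U_1,\dots,U_n,U_Y)\sim\mathcal{N}(\mu,\Sigma)$. The observable graph $G$ is the directed acyclic graph (DAG) on the observed variables with an edge from each variable in $Pa(V)$ to $V$; no treatment is a descendant of $Y$. An intervention on $\mathbf{S}\subseteq\mathbf{X}$ removes all edges (including those from latent variables) into $\mathbf{S}$; the resulting model is $\mathcal{M}_{do(\mathbf{S})}$ and the resulting graph is $G_{\overline{\mathbf{S}}}$. $\log$ is base 2. For any $\mathbf{S}\subseteq \mathbf{X}$ one may intervene and sample from $\mathcal{M}_{do(\mathbf{S})}$, and conditional independence tests on it correctly report whether two variables are d-connected in $G_{\overline{\mathbf{S}}}$ (with latent confounding included). Transitive closure and reduction. The transitive closure $G^{tc}$ of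 a DAG $G$ has an edge $V_i\to V_j$ exactly when $G$ has a directed path from $V_i$ to $V_j$. The transitive reduction $Tr(G)$ is the (unique) DAG with the minimum number of edges having the same transitive closure as $G$. Strongly separating set system. A collection $\{\mathbf{S}_1,\dots,\mathbf{S}_m\}$ of subsets of $\mathbf{X}$ such that for any pair $X_i,X_j$ there are members $\mathbf{S}_i,\mathbf{S}_j$ with $X_i\in\mathbf{S}_i\setminus\mathbf{S}_j$ and $X_j\in\mathbf{S}_j\setminus\mathbf{S}_i$; one with $m\le 2\lceil\log n\rceil$ exists. Subroutine LearnTransitiveClosure($\mathcal{M}$). Start with $\mathbf{E}=\emptyset$; fix a strongly separating set system $\{\mathbf{S}_1,\dots,\mathbf{S}_m\}$ with $m\le 2\lceil\log n\rceil$; for each $k$ and each pair $X_i\in\mathbf{S}_k$, $X_j\in\mathbf{V}\setminus\mathbf{S}_k$, use samples from $\mathcal{M}_{do(\mathbf{S}_k)}$ and, if $X_i$ and $X_j$ are dependent in $G_{\overline{\mathbf{S}_k}}$, add the directed edge $X_i\to X_j$ to $\mathbf{E}$. Output the graph $(\mathbf{V},\mathbf{E})$ as the transitive closure. Algorithm LearnObservableGraph($\mathcal{M}$) with parameters $\alpha$, $d_{\max}$. Start with $\mathbf{E}=\emptyset$ and a data collection consisting of observational samples. Repeat $4\alpha\, d_{\max}\log n$ times: form a random set $\mathbf{S}$ by including each $X_i\in\mathbf{X}$ independently with probability $1-\frac{1}{d_{\max}}$; run LearnTransitiveClosure($\mathcal{M}_{do(\mathbf{S})}$) to obtain $G_{\overline{\mathbf{S}}}^{tc}$;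 compute $Tr(G_{\overline{\mathbf{S}}}^{tc})$ and add any of its edges missing from $\mathbf{E}$ to $\mathbf{E}$; sample data from $\mathcal{M}_{do(\mathbf{S})}$ and add it to the data collection. Return the graph $(\mathbf{V},\mathbf{E})$ and the data collection. The algorithm ''returns the required interventional data sets'' if for every treatment $X_i\in\mathbf{X}$ at least one of the sampled sets $\mathbf{S}$ satisfies $Pa(X_i)\subseteq\mathbf{S}$ and $X_i\notin\mathbf{S}$.
   Formalization: The bound 8αd_max(log n)² is shown for some allowed separating system; for every one it is 8αd_max·log n·⌈log n⌉. The per-round data-collection samples from do(S) are not counted. The claim on the required data sets assumes d_max ≥ 2. *)

(* Defs.v *)
From HB Require Import structures.
From mathcomp Require Import all_boot all_order all_algebra.
From mathcomp Require Import all_classical all_reals all_analysis.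

Set Implicit Arguments.
Unset Strict Implicit.
Unset Printing Implicit Defensive.

Import Order.TTheory GRing.Theory Num.Theory.
Local Open Scope ring_scope.

Section Digraphs.
Variable T : finType.

Definition digraph := {set T * T}.

Definition edge (E : digraph) : rel T := fun x y => (x, y) \in E.

(* Only directed paths with at least one edge count. *)
Definition tclosure (E : digraph) : digraph :=
  [set e | [exists z, edge E e.1 z && connect (edge E) z e.2]].

Definition acyclic (E : digraph) : bool := [forall x, (x, x) \notin tclosure E].

(* Minimises the number of edges over the DAGs with the closure of E; when E is
   itself acyclic, it is a legitimate starting point for [arg min]. *)
Definition treduction (E : digraph) : digraph :=
  [arg min_(H < E | acyclic H && (tclosure H == tclosure E)) #|H|]%N.

Definition mutilate (E : digraph) (A : {set T}) : digraph :=
  [set e in E | e.2 \notin A].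

Definition degree (E : digraph) (x : T) : nat :=
  #|[set e in E | (e.1 == x) || (e.2 == x)]|.

Definition max_degree (E : digraph) : nat := (\max_(x : T) degree E x)%N.

Definition skeleton (E : digraph) : rel T := fun x y => edge E x y || edge E y x.

Definition collider (E : digraph) (a b c : T) : bool := edge E a b && edge E c b.

Definition active (E : digraph) (Z : {set T}) (a b c : T) : bool :=
  if collider E a b c then [exists z in Z, connect (edge E) b z]
  else b \notin Z.

Definition d_connected (E : digraph) (Z : {set T}) (x y : T) : Prop :=
  [/\ x \notin Z, y \notin Z &
    exists p : seq T,
      [/\ path (skeleton E) x p, last x p = y, uniq (x :: p) &
        forall (s1 : seq T) (a b c : T) (s2 : seq T),
          x :: p = s1 ++ [:: a; b; c] ++ s2 -> active E Z a b c]].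

End Digraphs.

(* [Some i] is the treatment X_i and [None] is the outcome Y. *)
Definition obs (n : nat) : finType := option 'I_n.

Definition treatments (n : nat) (S : {set 'I_n}) : {set obs n} :=
  [set Some i | i in S].

(* [normal_prob m 0] is not the point mass at m, so degenerate Gaussians are
   treated separately. *)
Definition gaussian_law (R : realType) (m v : R) (A : set R) : \bar R :=
  if v == 0 then dirac m A else normal_prob m (Num.sqrt v) A.

(* U ~ N(mu, Sigma): every linear combination is a univariate Gaussian with the
   induced mean and variance. *)
Definition jointly_gaussian (R : realType) (d : measure_display)
    (Omega : measurableType d) (P : probability Omega R) (I : finType)
    (U : I -> {RV P >-> R}) (mu : I -> R) (Sigma : I -> I -> R) : Prop :=
  [/\ forall i j, Sigma i j = Sigma j i,
      forall a : I -> R, 0 <= \sum_i \sum_j a i * a j * Sigma i j &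
      forall (a : I -> R) (A : set R), measurable A ->
        P (preimage (fun w => \sum_i a i * U i w) A) =
        gaussian_law (\sum_i a i * mu i)
                     (\sum_i \sum_j a i * a j * Sigma i j) A].

Definition graph_of_parents (n : nat) (pa : obs n -> {set obs n}) :
  digraph (obs n) := [set e | e.1 \in pa e.2].

Record gaussian_anm (R : realType) (n : nat) := GaussianANM {
  parents : obs n -> {set obs n};
  mechanism : obs n -> (obs n -> R) -> R;
  noise_mean : obs n -> R;
  noise_cov : obs n -> obs n -> R;
  anm_display : measure_display;
  anm_space : measurableType anm_display;
  anm_prob : probability anm_space R;
  noise : obs n -> {RV anm_prob >-> R};
  variable : obs n -> {RV anm_prob >-> R};
  mechanism_parents : forall v (x y : obs n -> R),
    {in parents v, x =1 y} -> mechanism v x = mechanism v y;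
  noise_gaussian : jointly_gaussian noise noise_mean noise_cov;
  structural_equation : forall v w,
    variable v w = mechanism v (fun u => variable u w) + noise v w;
  anm_acyclic : acyclic (graph_of_parents parents);
  outcome_no_descendant : forall i : 'I_n,
    (None, Some i) \notin tclosure (graph_of_parents parents)
}.

Section Causal.
Variables (R : realType) (n : nat).
Implicit Types (M : gaussian_anm R n) (S : {set 'I_n}).

Definition obs_graph M : digraph (obs n) := graph_of_parents (parents M).

(* [inr (u, v)] is a latent common cause of u and v; it is present exactly when
   the noises of u and v are correlated, and is isolated otherwise. *)
Definition full_node : finType := (obs n + obs n * obs n)%type.

Definition full_edge M : rel full_node := fun x y =>
  match x, y with
  | inl u, inl v => u \in parents M v
  | inr (u, v), inl t =>
      [&& u != v, noise_cov M u v != 0 & (t == u) || (t == v)]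
  | _, inr _ => false
  end.

Definition full_graph M : digraph full_node := [set e | full_edge M e.1 e.2].

Definition full_graph_do M S : digraph full_node :=
  mutilate (full_graph M) [set inl v | v in treatments S].

(* [test S u v] is the verdict (true = dependent) of the independence test for
   u and v on samples from the model under do(S). *)
Definition dependence_test := {set 'I_n} -> obs n -> obs n -> bool.

Definition test_correct M (test : dependence_test) : Prop :=
  forall S (u v : obs n), u != v ->
    test S u v <->
    d_connected (full_graph_do M S) (finset.set0 : {set full_node})
                (inl u) (inl v).

End Causal.

Section Algorithm.
Variable n : nat.
Implicit Types (S : {set 'I_n}) (sys : seq {set 'I_n})
  (test : dependence_test n).

Definition strongly_separating sys : Prop :=
  forall i j : 'I_n, i != j ->
    exists A B : {set 'I_n},
      [/\ A \in sys, B \in sys, i \in A :\: B & j \in B :\: A].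

Definition dependent_edges test D Sk : digraph (obs n) :=
  [set e | [&& e.1 \in treatments Sk, e.2 \notin treatments Sk
             & test D e.1 e.2]].

(* LearnTransitiveClosure on the model under do(S): intervening further on Sk
   gives the model under do(S :|: Sk). The result is the learned graph together
   with the list of interventions performed. *)
Definition learn_tclosure test sys S : digraph (obs n) * seq {set 'I_n} :=
  foldl (fun st Sk => let D := S :|: Sk in
           (st.1 :|: dependent_edges test D Sk, rcons st.2 D))
        (finset.set0, [::]) sys.

(* In [datasets], [None] stands for the observational samples and [Some S] for
   the samples from the model under do(S). [interventions] lists, with
   repetitions, the interventions performed to learn the graph. *)
Record learner := Learner {
  learned_graph : digraph (obs n);
  datasets : seq (option {set 'I_n});
  interventions : seq {set 'I_n}
}.

Definition learn_round test sys (st : learner) S : learner :=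
  let: (C, D) := learn_tclosure test sys S in
  Learner (learned_graph st :|: treduction C)
          (rcons (datasets st) (Some S))
          (interventions st ++ D).

(* LearnObservableGraph, given the random sets drawn in the successive
   repetitions. *)
Definition learn_observable_graph test sys (draws : seq {set 'I_n}) : learner :=
  foldl (learn_round test sys) (Learner finset.set0 [:: None] [::]) draws.

End Algorithm.

Definition required_data (R : realType) (n : nat) (M : gaussian_anm R n)
    (st : learner n) : bool :=
  [forall i : 'I_n, exists S : {set 'I_n},
    [&& Some S \in datasets st, parents M (Some i) \subset treatments S
      & i \notin S]].

Section Sampling.
Variables (R : realType) (n : nat).

Definition log2 (x : R) : R := ln x / ln 2.

(* A strongly separating system of at most 2 * ceil(log n) sets. *)
Definition admissible (sys : seq {set 'I_n}) : Prop :=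
  strongly_separating sys /\
  (size sys)%:R <= 2 * (Num.ceil (log2 n%:R))%:~R :> R.

(* The integer part of the real number of repetitions. *)
Definition repetitions (alpha : R) (dmax : nat) : nat :=
  Num.truncn (4 * alpha * dmax%:R * log2 n%:R).

Definition draw_prob (dmax : nat) (S : {set 'I_n}) : R :=
  \prod_(i < n) (if i \in S then 1 - dmax%:R^-1 else dmax%:R^-1).

(* Probability of an event on T independent draws. *)
Definition draws_prob (dmax T : nat) (A : pred (T.-tuple {set 'I_n})) : R :=
  \sum_(w : T.-tuple {set 'I_n} | A w) \prod_(S <- w) draw_prob dmax S.

End Sampling.

(* Main.v *)
Require Import Defs.
From HB Require Import structures.
From mathcomp Require Import all_boot all_order all_algebra.
From mathcomp Require Import all_classical all_reals all_analysis.
From mathcomp Require Import zify ring lra.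
From mathcomp Require Import fintype finset.
Import Order.TTheory GRing.Theory Num.Theory.
Local Open Scope ring_scope.
Set Implicit Arguments.
Unset Strict Implicit.
Unset Printing Implicit Defensive.

(* Only a directed path can be active when nothing is conditioned on and its
   starting point has been intervened on, so every edge found under do(S) is a
   directed path of the mutilated graph G_S; strong separation makes every edge
   of G_S appear. Hence the learned relation lies between G_S and its closure and
   its transitive reduction is the covering relation of G_S. An edge u -> v of G
   is a covering edge of G_S as soon as S contains the other parents of v but not
   v. With d = d_max >= 2, a draw contains all parents of v but not v with
   probability at least (1/d) (1 - 1/d)^d >= 1 / (4d), so v is missed by all draws
   with probability at most n^-alpha, and a union bound over the vertices
   concludes. *)

(** * Transitive closures and reductions *)

Section TransitiveReduction.
Variable T : finType.
Implicit Types (E G H : digraph T) (x y z u v w : T).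

Lemma tclosureP E x y :
  reflect (exists2 z, edge E x z & connect (edge E) z y)
          ((x, y) \in tclosure E).
Proof.
rewrite inE /=; apply: (iffP existsP) => [[z /andP[xz zy]]|[z xz zy]];
  by exists z => //; apply/andP.
Qed.

Lemma tclosure1 E x y : edge E x y -> (x, y) \in tclosure E.
Proof. by move=> xy; apply/tclosureP; exists y. Qed.

Lemma tclosure_connect E x y : (x, y) \in tclosure E -> connect (edge E) x y.
Proof. by case/tclosureP=> z /connect1; apply: connect_trans. Qed.

Lemma connect_tclosure E x y :
  connect (edge E) x y = (x == y) || ((x, y) \in tclosure E).
Proof.
apply/idP/idP => [/connectP[[|z p] /= pth ->]|].
- by rewrite eqxx.
- have /andP[xz zp] := pth.
  by apply/orP; right; apply/tclosureP; exists z => //; apply/connectP; exists p.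
- by case/orP=> [/eqP-> //|]; exact: tclosure_connect.
Qed.

Lemma tclosure_connect_trans E x y z :
  (x, y) \in tclosure E -> connect (edge E) y z -> (x, z) \in tclosure E.
Proof.
case/tclosureP=> w xw wy yz; apply/tclosureP; exists w => //.
exact: connect_trans wy yz.
Qed.

Lemma tclosure_trans E x y z :
  (x, y) \in tclosure E -> (y, z) \in tclosure E -> (x, z) \in tclosure E.
Proof. by move=> xy /tclosure_connect; apply: tclosure_connect_trans. Qed.

Lemma tclosure_last E x y : (x, y) \in tclosure E ->
  exists2 z, connect (edge E) x z & edge E z y.
Proof.
case/tclosureP=> w xw /connectP[p].
elim/last_ind: p => [_ ->|p z _]; first by exists x.
rewrite rcons_path last_rcons => /andP[wp pz] ->; exists (last w p) => //.
by apply: connect_trans (connect1 xw) _; apply/connectP; exists p.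
Qed.

Lemma tclosure_min E H :
  H \subset tclosure E -> tclosure H \subset tclosure E.
Proof.
move=> /subsetP sub; apply/subsetP => -[x y] /tclosureP[z xz /connectP[p zp ->]].
have {xz} : (x, z) \in tclosure E by apply: sub.
elim: p z zp => //= t p IHp z /andP[zt tp] xz.
by apply: IHp => //; apply: tclosure_trans xz _; apply: sub.
Qed.

Lemma sub_tclosure E : E \subset tclosure E.
Proof. by apply/subsetP => -[x y]; apply: tclosure1. Qed.

Lemma tclosureS G H : G \subset H -> tclosure G \subset tclosure H.
Proof. by move=> GH; apply: tclosure_min; apply: subset_trans GH (sub_tclosure H). Qed.

Lemma tclosure_between G H :
  G \subset H -> H \subset tclosure G -> tclosure H = tclosure G.
Proof. by move=> GH HG; apply/eqP; rewrite eqEsubset tclosure_min // tclosureS. Qed.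

Lemma acyclicS G H : G \subset H -> acyclic H -> acyclic G.
Proof.
move=> /tclosureS/subsetP GH /forallP acH; apply/forallP => x.
by apply: contra (acH x); apply: GH.
Qed.

Lemma acyclicN E x : acyclic E -> (x, x) \in tclosure E = false.
Proof. by move=> /forallP/(_ x)/negbTE. Qed.

Definition interval E u v : {set T} :=
  [set w | ((u, w) \in tclosure E) && ((w, v) \in tclosure E)].

Lemma in_interval E u v w : (w \in interval E u v) =
  ((u, w) \in tclosure E) && ((w, v) \in tclosure E).
Proof. by rewrite inE. Qed.

(** For acyclic [E] this is the Hasse diagram of the strict order [tclosure E]. *)
Definition covering E : digraph T :=
  [set e in tclosure E | interval E e.1 e.2 == set0].

Lemma in_covering E u v : ((u, v) \in covering E) =
  ((u, v) \in tclosure E) && (interval E u v == set0).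
Proof. by rewrite inE. Qed.

(** A path of [H] from [u] to [v] whose first step is not [v] would put the end of that step into
    the empty interval. *)
Lemma covering_sub E H : tclosure H = tclosure E -> covering E \subset H.
Proof.
move=> HE; apply/subsetP => -[u v]; rewrite in_covering -HE => /andP[uv /eqP iuv].
have /tclosureP[z uz] := uv; rewrite connect_tclosure => /orP[/eqP <- //|zv].
by have := in_set0 z; rewrite -iuv in_interval -HE zv tclosure1.
Qed.

(** Strong induction on the size of the interval: a vertex [w] between [u] and [v] splits the pair
    into two whose intervals are strictly smaller, because acyclicity keeps [w] out of both. *)
Lemma tclosure_covering E : acyclic E -> tclosure (covering E) = tclosure E.
Proof.
move=> acE; apply/eqP; rewrite eqEsubset; apply/andP; split.
  by apply: tclosure_min; apply/subsetP => e; rewrite inE => /andP[].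
apply/subsetP => -[u v].
have [k] := ubnP #|interval E u v|; elim: k u v => // k IHk u v; rewrite ltnS => lek uv.
have [iuv|[w]] := set_0Vmem (interval E u v).
  by apply: tclosure1; rewrite /edge in_covering uv iuv eqxx.
rewrite in_interval => /andP[uw wv].
apply: tclosure_trans (IHk u w _ uw) (IHk w v _ wv);
  apply: leq_trans lek; apply/proper_card/properP; split.
- apply/subsetP => z; rewrite !in_interval => /andP[-> zw] /=.
  exact: tclosure_trans zw wv.
- by exists w; rewrite !in_interval ?uw ?wv // (acyclicN _ acE).
- apply/subsetP => z; rewrite !in_interval => /andP[wz ->]; rewrite andbT.
  exact: tclosure_trans uw wz.
- by exists w; rewrite !in_interval ?uw ?wv // (acyclicN _ acE).
Qed.

(** The covering relation is a candidate for the minimum and is contained in every other candidate,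
    so a candidate of least size equals it. *)
Lemma treduction_covering E : acyclic E -> treduction E = covering E.
Proof.
move=> acE; rewrite /treduction; case: arg_minnP => [|H /andP[acH /eqP HE] minH].
  by rewrite acE eqxx.
apply/eqP; rewrite eq_sym eqEcard covering_sub //=; apply: minH.
rewrite tclosure_covering // eqxx andbT.
by apply: acyclicS acH; apply: covering_sub.
Qed.

Lemma eq_covering E H : tclosure E = tclosure H -> covering E = covering H.
Proof. by move=> EH; apply/setP => -[u v]; rewrite !in_covering /interval EH. Qed.

(** Learning any relation squeezed between a graph and its closure is enough, since the reduction
    depends on the closure alone. *)
Lemma treduction_between G H : acyclic G ->
  G \subset H -> H \subset tclosure G -> treduction H = covering G.
Proof.
move=> acG GH HG; have tcH := tclosure_between GH HG.
rewrite treduction_covering; first exact: eq_covering.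
by rewrite /acyclic tcH.
Qed.

Lemma mutilate_sub E (A : {set T}) : mutilate E A \subset E.
Proof. by apply/subsetP => e; rewrite inE => /andP[]. Qed.

(* A longer directed path from [u] to [v] would enter [v] through another
   parent of [v], whose incoming edges the intervention has removed. *)
Lemma covering_mutilate E (A : {set T}) u v : acyclic E ->
    edge E u v -> v \notin A ->
    (forall w, edge E w v -> w != u -> w \in A) ->
  (u, v) \in covering (mutilate E A).
Proof.
move=> acE uv vA parA.
have acM : acyclic (mutilate E A) by apply: acyclicS acE; apply: mutilate_sub.
have uvM : edge (mutilate E A) u v by rewrite /edge inE /= vA andbT.
rewrite in_covering tclosure1 //=; apply/eqP/setP => w; rewrite in_interval in_set0.
apply/negP => /andP[uw /tclosure_last[z wz]].
have uz := tclosure_connect_trans uw wz.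
rewrite /edge inE /= => /andP[zv _].
have [zu|zu] := eqVneq z u.
  by move: uz; rewrite zu (acyclicN _ acM).
have [t _] := tclosure_last uz.
by rewrite /edge inE /= parA ?andbF.
Qed.

(* Without conditioning no collider is active, so a path that starts with an
   outgoing edge is directed. *)
Lemma d_connected_source E x y : (forall z, ~~ edge E z x) -> x != y ->
  d_connected E set0 x y -> (x, y) \in tclosure E.
Proof.
move=> srcx xy [_ _ [p [pth lst _ act]]].
have : exists2 z, edge E x z & connect (edge E) z y; last by move/tclosureP.
case: p pth lst act => [_ /= xy'|z p]; first by rewrite xy' eqxx in xy.
rewrite /= /skeleton (negPf (srcx z)) orbF => /andP[xz] zp lst act.
exists z => //; elim: p x z xz zp lst act {srcx xy} => [|t p IHp] x z xz /=.
  by move=> _ ->.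
case/andP=> zt tp lst act.
have := act [::] x z t p erefl; rewrite /active /collider xz /=.
case: ifP => [_ /existsP[a]|tz _]; first by rewrite inE.
move: zt; rewrite /skeleton tz orbF => zt.
apply: connect_trans (connect1 zt) _; apply: (IHp z t) => // s1 a b c s2 eqs.
by apply: (act (x :: s1) a b c s2); rewrite eqs.
Qed.

Lemma edge_d_connected E x y : edge E x y -> x != y ->
  d_connected E set0 x y.
Proof.
move=> xy neq; split; rewrite ?inE //; exists [:: y]; split => //=.
- by rewrite /skeleton xy.
- by rewrite inE neq.
- by move=> [|? [|? [|? ?]]].
Qed.

End TransitiveReduction.

(** * Correctness of the learning algorithm *)

Section Algorithm.
Variables (n : nat) (test : dependence_test n) (sys : seq {set 'I_n}).
Implicit Types (S : {set 'I_n}) (w : seq {set 'I_n}).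

Lemma mem_treatments S (i : 'I_n) : (Some i \in treatments S) = (i \in S).
Proof. by rewrite mem_imset //; apply: Some_inj. Qed.

Lemma outcome_treatments S : None \notin treatments S.
Proof. by apply/imsetP => -[]. Qed.

Lemma sub_treatments (A B : {set 'I_n}) :
  A \subset B -> treatments A \subset treatments B.
Proof. exact: imsetS. Qed.

Lemma mem_learn_tclosure S e :
  (e \in (learn_tclosure test sys S).1) =
  has (fun Sk => e \in dependent_edges test (S :|: Sk) Sk) sys.
Proof.
rewrite /learn_tclosure; elim/last_ind: sys => [|s Sk IHs]; first by rewrite inE.
by rewrite foldl_rcons /= in_setU IHs has_rcons orbC.
Qed.

Lemma size_learn_tclosure S : size (learn_tclosure test sys S).2 = size sys.
Proof.
rewrite /learn_tclosure; elim/last_ind: sys => [|s Sk IHs] //.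
by rewrite foldl_rcons /= !size_rcons IHs.
Qed.

Lemma learn_observable_graph_rcons w S :
  learn_observable_graph test sys (rcons w S) =
  learn_round test sys (learn_observable_graph test sys w) S.
Proof. exact: foldl_rcons. Qed.

Lemma mem_learned_graph w e :
  (e \in learned_graph (learn_observable_graph test sys w)) =
  has (fun S => e \in treduction (learn_tclosure test sys S).1) w.
Proof.
elim/last_ind: w => [|w S IHw]; first by rewrite inE.
rewrite learn_observable_graph_rcons /learn_round has_rcons -IHw.
by case: learn_tclosure => C D /=; rewrite in_setU orbC.
Qed.

Lemma datasets_learn_observable_graph w :
  datasets (learn_observable_graph test sys w) = None :: map Some w.
Proof.
elim/last_ind: w => [|w S IHw] //.
rewrite learn_observable_graph_rcons /learn_round; case: learn_tclosure => C D /=.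
by rewrite IHw map_rcons.
Qed.

Lemma size_interventions w :
  size (interventions (learn_observable_graph test sys w)) =
  (size w * size sys)%N.
Proof.
elim/last_ind: w => [|w S IHw] //.
rewrite learn_observable_graph_rcons /learn_round.
case: learn_tclosure (size_learn_tclosure S) => C D /= sD.
by rewrite size_cat IHw sD size_rcons mulSn addnC.
Qed.

End Algorithm.

(** * The graph recovered from a correct independence test *)

Section Learning.
Variables (R : realType) (n : nat) (M : gaussian_anm R n).
Implicit Types (S D : {set 'I_n}) (u v : obs n).

Lemma edge_obs_graph u v : edge (obs_graph M) u v = (u \in parents M v).
Proof. by rewrite /edge inE. Qed.

Lemma acyclic_obs_graph : acyclic (obs_graph M).
Proof. exact: anm_acyclic. Qed.

Lemma parents_irr v : v \notin parents M v.
Proof.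
rewrite -edge_obs_graph; apply/negP => /tclosure1.
by rewrite (acyclicN _ acyclic_obs_graph).
Qed.

Lemma outcome_parents v : None \notin parents M v.
Proof.
case: v => [i|]; last exact: parents_irr.
rewrite -edge_obs_graph; apply/negP => /tclosure1.
by apply/negP; apply: outcome_no_descendant.
Qed.

Lemma edge_mutilate_obs S u v :
  edge (mutilate (obs_graph M) (treatments S)) u v =
  (u \in parents M v) && (v \notin treatments S).
Proof. by rewrite /edge !inE. Qed.

Lemma edge_full_graph_do D u v :
  edge (full_graph_do M D) (inl u) (inl v) =
  edge (mutilate (obs_graph M) (treatments D)) u v.
Proof. by rewrite /edge !inE /= mem_imset //; move=> x y []. Qed.

Lemma full_graph_do_target D x :
  forall y, x \in treatments D -> ~~ edge (full_graph_do M D) y (inl x).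
Proof.
move=> y xD; rewrite /edge inE /= negb_and negbK; apply/orP; right.
exact: imset_f.
Qed.

(** Latent vertices have no incoming edge, so a directed path that starts at an observed vertex
    never meets one. *)
Lemma tclosure_full_graph_do D u v :
  (inl u, inl v) \in tclosure (full_graph_do M D) ->
  (u, v) \in tclosure (mutilate (obs_graph M) (treatments D)).
Proof.
have edgeN x y : edge (full_graph_do M D) x (inr y) = false.
  by rewrite /edge !inE /=; case: x => [?|[]].
have conn x y : connect (edge (full_graph_do M D)) (inl x) (inl y) ->
    connect (edge (mutilate (obs_graph M) (treatments D))) x y.
  move=> /connectP[p pth lst]; elim: p x pth lst => [x _ [->] //|[z|z] p IHp] x /=.
    rewrite edge_full_graph_do => /andP[/connect1 xz] zp /(IHp _ zp).
    exact: connect_trans.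
  by rewrite edgeN.
case/tclosureP=> -[z|z]; last by rewrite edgeN.
by rewrite edge_full_graph_do => uz /conn zv; apply/tclosureP; exists z.
Qed.

Variables (test : dependence_test n) (sys : seq {set 'I_n}).
Hypotheses (test_ok : test_correct M test) (sep : strongly_separating sys).
Hypothesis n_gt1 : (1 < n)%N.

Lemma dependent_edges_sub S Sk :
  dependent_edges test (S :|: Sk) Sk \subset
  tclosure (mutilate (obs_graph M) (treatments S)).
Proof.
apply/subsetP => -[u v]; rewrite inE /= => /and3P[uSk vSk].
have uv : u != v by apply: contraNneq vSk => <-.
move=> /(test_ok _ uv)/d_connected_source.
have uD : u \in treatments (S :|: Sk).
  by apply: subsetP uSk; apply: sub_treatments; apply: subsetUr.
move=> /(_ (fun z => full_graph_do_target _ uD)) dep.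
have /dep/tclosure_full_graph_do : inl u != inl v :> full_node n by [].
apply: subsetP; apply: tclosureS; apply/subsetP => -[x y].
rewrite -2![_ \in _]/(edge _ x y) !edge_mutilate_obs => /andP[-> yD] /=.
by apply: contra yD; apply: subsetP; apply: sub_treatments; apply: subsetUl.
Qed.

Lemma dependent_edges_edge S Sk u v :
    edge (mutilate (obs_graph M) (treatments S)) u v ->
    u \in treatments Sk -> v \notin treatments Sk ->
  (u, v) \in dependent_edges test (S :|: Sk) Sk.
Proof.
move=> uv uSk vSk; rewrite inE /= uSk vSk.
have neq : u != v by apply: contraNneq vSk => <-.
apply/(test_ok _ neq)/edge_d_connected; last exact: neq.
move: uv; rewrite edge_full_graph_do !edge_mutilate_obs => /andP[-> vS] /=.
case: v {neq} vSk vS => [j|]; last by move=> *; apply: outcome_treatments.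
by rewrite !mem_treatments in_setU negb_or => -> ->.
Qed.

(* The closure is not learned literally: a directed path may be cut by every
   separating set. What is learned lies between the graph and its closure. *)
Lemma treduction_learn_tclosure S :
  treduction (learn_tclosure test sys S).1 =
  covering (mutilate (obs_graph M) (treatments S)).
Proof.
apply: treduction_between.
- by apply: acyclicS acyclic_obs_graph; apply: mutilate_sub.
- apply/subsetP => -[u v] uv; rewrite mem_learn_tclosure.
  have /andP[pa _] : (u \in parents M v) && (v \notin treatments S).
    by rewrite -edge_mutilate_obs.
  case: u pa uv => [i|]; last by rewrite (negPf (outcome_parents v)).
  move=> iv uv.
  have [A [Asys iA vA]] : exists A, [/\ A \in sys, i \in A & v \notin treatments A].
    case: v iv {uv} => [j|] iv.
      have ij : i != j.
        by apply: contraTneq iv => ->; apply: parents_irr.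
      have [A [B [Asys _]]] := sep ij.
      rewrite !in_setD => /andP[_ iA] /andP[jA _].
      by exists A; rewrite ?mem_treatments.
    (* Strong separation speaks of pairs of treatments only. For an edge into the outcome, a set
       containing [i] is obtained from a second treatment, which exists because [n > 1]. *)
    have [j ij] : exists j, i != j.
      have /set0Pn[j] : [set~ i] != set0.
        by rewrite -card_gt0 cardsC1 card_ord; case: (n) n_gt1 => [|[]].
      by rewrite !inE eq_sym; exists j.
    have [A [B [Asys _ /setDP[iA _] _]]] := sep ij.
    by exists A; rewrite ?outcome_treatments.
  apply/hasP; exists A => //; apply: dependent_edges_edge => //.
  by rewrite mem_treatments.
- apply/subsetP => e; rewrite mem_learn_tclosure => /hasP[Sk _].
  by apply: subsetP; apply: dependent_edges_sub.
Qed.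

(** No false edge is ever added, since a covering edge of a mutilated graph is an edge of that
    graph. The parent [u] itself may lie outside [S], so an empty draw already reveals the edge into
    a vertex with a single parent. *)
Lemma learned_graph_eq (w : seq {set 'I_n}) :
    (forall u v, u \in parents M v -> exists2 S, S \in w &
       (v \notin treatments S) && (parents M v :\ u \subset treatments S)) ->
  learned_graph (learn_observable_graph test sys w) = obs_graph M.
Proof.
move=> cov; apply/setP => -[u v]; rewrite mem_learned_graph.
apply/hasP/idP => [[S _]|uv].
  rewrite treduction_learn_tclosure; apply: subsetP.
  exact: subset_trans (covering_sub erefl) (mutilate_sub _ _).
have [S Sw /andP[vS /subsetP paS]] : exists2 S, S \in w &
    (v \notin treatments S) && (parents M v :\ u \subset treatments S).
  by apply: cov; rewrite -edge_obs_graph.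
exists S => //; rewrite treduction_learn_tclosure.
apply: covering_mutilate => //; first exact: acyclic_obs_graph.
by move=> t; rewrite edge_obs_graph => tv tu; apply: paS; rewrite !inE tu.
Qed.

Lemma card_parents v : (#|parents M v| <= max_degree (obs_graph M))%N.
Proof.
apply: leq_trans (leq_bigmax v); rewrite /degree.
have <- : #|[set (u, v) | u in parents M v]| = #|parents M v|.
  by rewrite card_imset // => x y [].
apply/subset_leq_card/subsetP => _ /imsetP[u uv ->].
by rewrite !inE uv eqxx orbT.
Qed.

End Learning.

(** * Small strongly separating systems *)

Section SpernerSystem.

Lemma bin_double_succ k : 'C(k.+1.*2, k.+1) = ('C(k.*2.+1, k)).*2.
Proof.
rewrite doubleS binS -[RHS]addnn; congr addn.
by rewrite -bin_sub; [congr binomial; lia | lia].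
Qed.

(** The bound fails at [k = 2], where 8 exceeds 6, and starts at [k = 3] with 16 against 20. Each
    further step doubles the left side and at least doubles the right side. *)
Lemma central_bin_lb k : (2 < k)%N -> (2 ^ k.+1 <= 'C(k.*2, k))%N.
Proof.
elim: k => // k IHk; rewrite ltnS leq_eqVlt => /orP[/eqP <- //|k_gt2].
rewrite bin_double_succ expnS mul2n leq_double.
apply: leq_trans (IHk k_gt2) _; rewrite leq_bin2l //.
Qed.

(* Sharper than the binary-code system, of size [2 * ceil (log n)]: the middle
   layer of the subsets of [m] points already has [n] elements when
   [m = floor (2 * log n)]. *)
Lemma middle_layer_lb n m : (n ^ 2 < 2 ^ m.+1)%N -> (n <= 'C(m, m./2))%N.
Proof.
(* [central_bin_lb] is applied at [m./2] for even [m] and at [m./2 + 1] for odd [m]. These exceed 2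
   once [m] is at least 5; smaller values are checked directly. *)
have [m_lt5|m_ge5] := ltnP m 5.
  case: m m_lt5 => [|[|[|[|[|m]]]]] // _; rewrite ?binE /=.
  all: try by (case: n => [|[|[|[|[|[|[|n]]]]]]] //; rewrite !expnS; nia).
rewrite -{1 2}(odd_double_half m); set k := m./2.
have [odd_m|even_m] := boolP (odd m) => /= lt_n.
  have : (2 ^ k.+2 <= ('C(k.*2.+1, k)).*2)%N.
    by rewrite -bin_double_succ central_bin_lb //; rewrite /k; lia.
  rewrite expnS mul2n leq_double add1n; apply: leq_trans.
  rewrite -(@leq_exp2r _ _ 2) // -expnM muln2 doubleS.
  by rewrite add1n in lt_n; apply: ltnW.
rewrite add0n in lt_n *.
have k_gt2 : (2 < k)%N by rewrite /k; lia.
apply: leq_trans (central_bin_lb k_gt2).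
rewrite -(@leq_exp2r _ _ 2) // -expnM muln2 doubleS.
by apply: leq_trans (ltnW lt_n) _; rewrite leq_exp2l.
Qed.

(** Code the treatments by distinct [k]-subsets of [m] points. Distinct sets of equal size are
    incomparable, so for each pair some point lies in the first code only and some point in the
    second only. The system has one set per point, formed by the treatments whose code contains
    it. *)
Lemma strongly_separating_layer n m k : (n <= 'C(m, k))%N ->
  exists2 sys : seq {set 'I_n}, strongly_separating sys & size sys = m.
Proof.
move=> le_n; pose L := [set A : {set 'I_m} | #|A| == k].
have cardL : #|L| = 'C(m, k) by rewrite card_draws card_ord.
have le_nL : (n <= #|L|)%N by rewrite cardL.
pose f (i : 'I_n) := enum_val (widen_ord le_nL i).
have cardf i : #|f i| = k by have := enum_valP (widen_ord le_nL i); rewrite inE => /eqP.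
have ex (i j : 'I_n) : i != j -> exists x, (x \in f i) && (x \notin f j).
  move=> ij; apply/existsP; apply: contraR ij; rewrite negb_exists => /forallP fij.
  have : f i = f j.
    apply/eqP; rewrite eqEcard !cardf leqnn andbT; apply/subsetP => x xi.
    by have := fij x; rewrite xi negbK.
  by move/enum_val_inj/(congr1 val) => /= /val_inj ->.
pose sets := [seq [set i | x \in f i] | x <- enum 'I_m].
exists sets; last by rewrite size_map size_enum_ord.
move=> i j ij; have [x /andP[xi xj]] := ex _ _ ij.
have [y /andP[yj yi]] := ex j i (contra_neq esym ij).
exists [set i | x \in f i], [set i | y \in f i].
by split; rewrite ?inE ?xi ?xj ?yi ?yj // map_f // mem_enum.
Qed.

(** The size is the integer part of the binary logarithm of [n ^ 2]; the inequality on powers states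
    without logarithms that it is at most [2 * log n]. *)
Lemma strongly_separating_exists n : (0 < n)%N ->
  exists2 sys : seq {set 'I_n}, strongly_separating sys & (2 ^ size sys <= n ^ 2)%N.
Proof.
move=> n_gt0; have n2_gt0 : (0 < n ^ 2)%N by rewrite expn_gt0 n_gt0.
have /andP[lo hi] := trunc_log_bounds (isT : (1 < 2)%N) n2_gt0.
have [sys sep sz] := strongly_separating_layer (middle_layer_lb hi).
by exists sys; rewrite ?sz.
Qed.

End SpernerSystem.

(** * Independent draws *)

(** Independence of the draws, as distributivity: the power of the sum expands into a sum over
    functions from indices to [X], which are the tuples. *)
Lemma sum_tuple_prod (R : comPzSemiRingType) (X : finType) (T : nat)
    (B : pred X) (f : X -> R) :
  \sum_(w : T.-tuple X | all B w) \prod_(x <- w) f x =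
  (\sum_(x | B x) f x) ^+ T.
Proof.
have -> : (\sum_(x | B x) f x) ^+ T = \prod_(i < T) \sum_(x | B x) f x.
  by rewrite prodr_const card_ord.
rewrite bigA_distr_big.
rewrite (reindex (fun g : {ffun 'I_T -> X} => [tuple g i | i < T])) /=; last first.
  exists (fun w : T.-tuple X => [ffun i => tnth w i]) => [g _|w _].
    by apply/ffunP => i; rewrite ffunE tnth_mktuple.
  by apply: eq_from_tnth => i; rewrite tnth_mktuple ffunE.
apply: eq_big => [g|g _].
  apply/allP/ffun_onP => [Bg i|Bg _ /mapP[i _ ->]]; last exact: Bg.
  by apply: Bg; apply: map_f; rewrite mem_enum.
by rewrite big_map big_enum.
Qed.

Section DrawsProb.
Variables (R : realType) (n d T : nat).
Implicit Types (S : {set 'I_n}) (A B : pred (T.-tuple {set 'I_n})).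

Lemma draw_prob_ge0 S : 0 <= draw_prob R d S.
Proof.
apply: prodr_ge0 => i _; case: ifP => _; last by rewrite invr_ge0.
(* At [d = 0] the inverse is 0 by convention and the factor is 1. *)
by case: d => [|k]; rewrite ?invr0 ?subr0 // subr_ge0 invf_le1 ?ler1n ?ltr0n.
Qed.

Lemma draw_prob_event (P N : {set 'I_n}) : [disjoint P & N] ->
  \sum_(S : {set 'I_n} | (P \subset S) && [disjoint N & S]) draw_prob R d S =
  (1 - d%:R^-1) ^+ #|P| * d%:R^-1 ^+ #|N|.
Proof.
move=> PN.
(* Setting the forbidden factors to 0 turns the restricted sum into a sum over all sets, which
   factors over the coordinates. *)
pose F (i : 'I_n) : R := if i \in N then 0 else 1 - d%:R^-1.
pose G (i : 'I_n) : R := if i \in P then 0 else d%:R^-1.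
have -> : \sum_(S : {set 'I_n} | (P \subset S) && [disjoint N & S]) draw_prob R d S =
          \sum_(S : {set 'I_n}) \prod_i (if i \in S then F i else G i).
  rewrite big_mkcond; apply: eq_bigr => S _.
  case: ifPn => [/andP[/subsetP PS NS]|].
    apply: eq_bigr => i _; rewrite /F /G.
    case: ifPn => [iS|iS].
      by case: ifPn => // iN; rewrite (disjointFr NS iN) in iS.
    by case: ifPn => // /PS; rewrite (negPf iS).
  rewrite negb_and => /orP[/subsetPn[i iP iS]|].
    by rewrite (bigD1 i) //= (negPf iS) /G iP mul0r.
  rewrite -setI_eq0 => /set0Pn[i]; rewrite inE => /andP[iN iS].
  by rewrite (bigD1 i) //= iS /F iN mul0r.
transitivity (\prod_i (F i + G i)); first by rewrite bigA_distr.
rewrite (eq_bigr (fun i => (if i \in P then 1 - d%:R^-1 else 1) *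
                           (if i \in N then d%:R^-1 else 1))); last first.
  move=> i _; rewrite /F /G; have [iN|_] := boolP (i \in N).
    by rewrite (disjointFl PN iN) add0r mul1r.
  by case: ifP; rewrite mulr1 ?addr0 ?subrK.
by rewrite big_split /= -!big_mkcond !prodr_const.
Qed.

Lemma sum_draw_prob : \sum_(S : {set 'I_n}) draw_prob R d S = 1.
Proof.
have := @draw_prob_event set0 set0; rewrite !cards0 !expr0 mulr1 => <-.
  by apply: eq_bigl => S; rewrite sub0set -setI_eq0 set0I eqxx.
by rewrite -setI_eq0 set0I.
Qed.

Lemma draws_prob_ge0 A : 0 <= draws_prob R d A.
Proof. by apply: sumr_ge0 => w _; apply: prodr_ge0 => S _; apply: draw_prob_ge0. Qed.

Lemma draws_prob_all (B : pred {set 'I_n}) :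
  draws_prob R d (fun w : T.-tuple _ => all B w) =
  (\sum_(S | B S) draw_prob R d S) ^+ T.
Proof. exact: sum_tuple_prod. Qed.

Lemma draws_probT A : (forall w, A w) -> draws_prob R d A = 1.
Proof.
move=> allA; rewrite -(expr1n _ T) -sum_draw_prob -draws_prob_all.
by apply: eq_bigl => w; rewrite allA all_predT.
Qed.

Lemma draws_prob_union (I : finType) (B : I -> pred (T.-tuple {set 'I_n})) A :
    (forall w, ~~ A w -> exists i, B i w) ->
  1 - \sum_i draws_prob R d (B i) <= draws_prob R d A.
Proof.
move=> cov; rewrite lerBlDr -(@draws_probT predT) //.
rewrite /draws_prob (bigID A) /= lerD2l.
rewrite (exchange_big_dep predT) //= big_mkcond; apply: ler_sum => w _.
have wt_ge0 : 0 <= \prod_(S <- w) draw_prob R d S.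
  by apply: prodr_ge0 => S _; apply: draw_prob_ge0.
case: ifPn => [/cov[i iw]|_]; last by apply: sumr_ge0.
by rewrite (bigD1 i) //= lerDl sumr_ge0.
Qed.

End DrawsProb.

(** * Numerical estimates for the probability of a miss *)

Section Estimates.
Variable R : realType.

Lemma bernoulli_ineq (x : R) m : 0 <= x -> 1 + x *+ m <= (1 + x) ^+ m.
Proof.
move=> x_ge0; elim: m => [|m IHm]; first by rewrite addr0.
rewrite exprS; apply: (@le_trans _ _ ((1 + x) * (1 + x *+ m))).
  by rewrite mulrS; have : 0 <= x *+ m := mulrn_wge0 m x_ge0; nra.
by rewrite ler_wpM2l // addr_ge0.
Qed.

(* [(1 - 1/d)^d] is nondecreasing in [d], with value [1/4] at [d = 2]. *)
Lemma quarter_le_exprn d : (1 < d)%N -> 4^-1 <= (1 - d%:R^-1 : R) ^+ d.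
Proof.
case: d => [|[|k]] // _; elim: k => [|k]; first by lra.
set a := 1 - k.+2%:R^-1; set b := 1 - k.+3%:R^-1 => /le_trans; apply.
have k_ge0 : 0 <= k%:R :> R by apply: ler0n.
(* The ratio [b / a] is [(k+2)^2 / ((k+1)(k+3)) = 1 + x]. Bernoulli's inequality bounds
   [(1 + x) ^+ k.+3] below by [1 + 1/(k+1)], the inverse of [a], which pays for the extra factor
   [a]. *)
pose x : R := (k.+1%:R * k.+3%:R)^-1.
have aE : a = k.+1%:R / k.+2%:R by rewrite /a -!natr1; field; lra.
have bE : b = a * (1 + x) by rewrite aE /b /x -!natr1; field; lra.
have a_ge0 : 0 <= a by rewrite aE.
have x_ge0 : 0 <= x by rewrite invr_ge0 mulr_ge0.
rewrite bE exprMn [a ^+ k.+3]exprSr -mulrA ler_peMr ?exprn_ge0 //.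
apply: le_trans (ler_wpM2l a_ge0 (bernoulli_ineq _ x_ge0)).
suff -> : a * (1 + x *+ k.+3) = 1 by [].
by rewrite -mulr_natr aE /x -!natr1; field; lra.
Qed.

Lemma ln2_le : ln 2 <= 7 / 8 :> R.
Proof.
rewrite -ler_expR lnK ?posrE //.
(* [1 + 7/8] falls short of 2, but the square of [1 + 7/16] is [529/256 > 2]. *)
have -> : 7 / 8 = 7 / 16 + 7 / 16 :> R by lra.
have := expR_ge1Dx (7 / 16 : R); rewrite expRD; nra.
Qed.

Lemma log2_ge1 n : (1 < n)%N -> 1 <= log2 n%:R :> R.
Proof.
move=> n_gt1; have ln2_gt0 : 0 < ln 2 :> R by apply: ln_gt0; lra.
by rewrite /log2 ler_pdivlMr // mul1r ler_ln ?posrE ?ltr0n ?ler_nat // ltnW.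
Qed.

Lemma log2_ge0 n : 0 <= log2 n%:R :> R.
Proof.
case: n => [|[|n]]; rewrite ?/log2 ?ln1 ?mul0r //; last by apply: le_trans (log2_ge1 _).
by rewrite ln0 // mul0r.
Qed.

(* Since [1 < 1 / ln 2], measuring the repetitions with the binary logarithm
   leaves enough slack to absorb the rounding of their number. *)
Lemma miss_prob n d (alpha p : R) : (1 < n)%N -> (1 < d)%N -> 1 <= alpha ->
    (4 * d%:R)^-1 <= p <= 1 ->
  (1 - p) ^+ repetitions n alpha d <= n%:R `^ (- alpha).
Proof.
move=> n_gt1 d_gt1 alpha_ge1 /andP[p_lo p_le1].
have ln2_gt0 : 0 < ln 2 :> R by apply: ln_gt0; lra.
have L_ge1 := log2_ge1 n_gt1; set L := log2 n%:R in L_ge1.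
have d_ge2 : 2 <= d%:R :> R by rewrite ler_nat.
have n_neq0 : n%:R != 0 :> R by rewrite pnatr_eq0 -lt0n ltnW.
have lnE : ln n%:R = L * ln 2 by rewrite /L /log2 divfK // gt_eqF.
rewrite /powR (negPf n_neq0) lnE.
set T := repetitions n alpha d.
have T_gt : 4 * alpha * d%:R * L < T%:R + 1.
  by rewrite natr1; apply: truncnS_gt.
have -> : - alpha * (L * ln 2) = - (alpha * (L * ln 2)) by rewrite mulNr.
apply: (@le_trans _ _ (expR (- p) ^+ T)).
  by rewrite lerXn2r ?nnegrE ?expR_ge0 ?subr_ge0 //; apply: expR_ge1Dx.
rewrite -expRM_natl ler_expR mulrN lerN2.
(* Rounding loses less than one repetition, hence less than [1 / (4d) <= 1/8] here. As
   [alpha * L >= 1], the gap between [ln 2 <= 7/8] and 1 makes up for it. *)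
have T_ge : alpha * L - 1 / 8 <= T%:R * (4 * d%:R)^-1.
  by rewrite ler_pdivlMr; [nra|lra].
apply: (@le_trans _ _ (T%:R * (4 * d%:R)^-1)); last by rewrite ler_wpM2l.
apply: le_trans T_ge.
have aL : 1 <= alpha * L by nra.
have := ln2_le; nra.
Qed.

End Estimates.

(** * Success probabilities *)

Section Guarantees.
Variables (R : realType) (n : nat) (M : gaussian_anm R n).
Implicit Types (S : {set 'I_n}) (v : obs n).

(** Asking for all parents, and not only those other than a given [u], gives one event for all edges
    into [v], so the union bound runs over vertices. For a treatment it is also the condition in
    [required_data]. *)
Definition isolates v S :=
  (v \notin treatments S) && (parents M v \subset treatments S).

Lemma isolates_prob d v : (1 < d)%N -> (#|parents M v| <= d)%N ->
  (4 * d%:R)^-1 <= \sum_(S | isolates v S) draw_prob R d S <= 1.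
Proof.
move=> d_gt1 le_d; apply/andP; split; last first.
  rewrite -(sum_draw_prob R n d) [leRHS](bigID (isolates v)) /= lerDl.
  by apply: sumr_ge0 => S _; apply: draw_prob_ge0.
(* [N] is a singleton for a treatment and empty for the outcome, which no draw contains; so the
   excluded part costs at most one factor [1/d]. *)
pose P := [set i | Some i \in parents M v]; pose N := [set i : 'I_n | Some i == v].
have PN : [disjoint P & N].
  rewrite -setI_eq0; apply/eqP/setP => i; rewrite !inE.
  by apply/negP => /andP[iv /eqP vE]; move: iv; rewrite vE (negPf (parents_irr M v)).
have eqE S : isolates v S = (P \subset S) && [disjoint N & S].
  rewrite /isolates andbC; congr (_ && _).
    apply/subsetP/subsetP => sub.
      by move=> i; rewrite inE => /sub; rewrite mem_treatments.
    case=> [i|] iv; last by rewrite (negPf (outcome_parents M v)) in iv.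
    by rewrite mem_treatments sub // inE.
  case: (v) @N {PN} => [j|] N.
    have -> : N = [set j] by apply/setP => i; rewrite !inE.
    by rewrite mem_treatments disjoints1.
  have -> : N = set0 by apply/setP => i; rewrite !inE.
  by rewrite outcome_treatments -setI_eq0 set0I eqxx.
rewrite (eq_bigl _ _ eqE) draw_prob_event //.
have d_gt0 : 0 < d%:R :> R by rewrite ltr0n ltnW.
have dV_ge0 : 0 <= d%:R^-1 :> R by rewrite invr_ge0 ltW.
have dV_le1 : d%:R^-1 <= 1 :> R by rewrite invf_le1 // ler1n ltnW.
have SomeI : injective (@Some 'I_n) by move=> x y [].
have cardP : (#|P| <= d)%N.
  apply: leq_trans le_d; rewrite -(card_imset _ SomeI).
  by apply/subset_leq_card/subsetP => _ /imsetP[i iP ->]; rewrite inE in iP.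
have cardN : (#|N| <= 1)%N.
  apply/card_le1P => i iN j; rewrite !inE in iN *.
  by rewrite -(eqP iN) (inj_eq SomeI).
rewrite invfM; apply: ler_pM; rewrite ?invr_ge0 //.
  apply: le_trans (quarter_le_exprn R d_gt1) _.
  by apply: ler_wiXn2l cardP; lra.
by apply: le_trans (ler_wiXn2l _ _ cardN); rewrite ?expr1.
Qed.

Lemma miss_isolates d alpha v :
    (1 < n)%N -> (1 < d)%N -> 1 <= alpha -> (#|parents M v| <= d)%N ->
  draws_prob R d (fun w : (repetitions n alpha d).-tuple {set 'I_n} =>
                    all (predC (isolates v)) w) <= n%:R `^ (- alpha).
Proof.
move=> n_gt1 d_gt1 alpha_ge1 /(isolates_prob d_gt1) p_bounds.
rewrite draws_prob_all; apply: le_trans (miss_prob n_gt1 d_gt1 alpha_ge1 p_bounds).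
suff -> : 1 - \sum_(S | isolates v S) draw_prob R d S =
          \sum_(S | predC (isolates v) S) draw_prob R d S by [].
by rewrite -(sum_draw_prob R n d) [X in X - _](bigID (isolates v)) /= addrAC subrr add0r.
Qed.

Lemma powR_natM k (x : R) : (0 < n)%N ->
  n%:R ^+ k * n%:R `^ (- x) = 1 / n%:R `^ (x - k%:R).
Proof.
move=> n_gt0; rewrite div1r -powRN opprB powRD; last by rewrite pnatr_eq0 -lt0n n_gt0 implybT.
by rewrite powR_mulrn.
Qed.

(** Disposes of the small values of [alpha], for which the claimed probability bounds are not
    positive. *)
Lemma trivial_bound (x : R) : (0 < n)%N -> x <= 0 -> 1 - 1 / n%:R `^ x <= 0.
Proof.
move=> n_gt0 x_le0; rewrite subr_le0 div1r -powRN.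
by rewrite -[leLHS](powRr0 n%:R) ler_powR ?ler1n // oppr_ge0.
Qed.

Variables (test : dependence_test n) (sys : seq {set 'I_n}) (d : nat).
Hypotheses (test_ok : test_correct M test) (sep : strongly_separating sys).
Hypotheses (n_gt0 : (0 < n)%N) (deg : (max_degree (obs_graph M) <= d)%N).

Let le_d v : (#|parents M v| <= d)%N := leq_trans (card_parents M v) deg.

(** A failed run has an edge [u -> v] that no draw exposes. The union bound over vertices needs
    [d > 1]; the cases [d = 0] and [d = 1] are treated apart and succeed with probability 1. *)
Lemma learned_graph_prob (alpha : R) :
  1 - 1 / n%:R `^ (alpha - 2) <=
  draws_prob R d (fun w : (repetitions n alpha d).-tuple {set 'I_n} =>
    learned_graph (learn_observable_graph test sys w) == obs_graph M).
Proof.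
have [alpha_le2|alpha_gt2] := leP alpha 2.
  by apply: le_trans (trivial_bound _ _) (draws_prob_ge0 _ _ _); rewrite ?subr_le0.
case: (ltngtP n 1) n_gt0 => // [n_gt1|n1] _; last first.
  apply: le_trans (draws_prob_ge0 _ _ _).
  by rewrite n1 powR1 divr1 subrr.
have failE (w : seq {set 'I_n}) :
    learned_graph (learn_observable_graph test sys w) != obs_graph M ->
    exists v, [exists u in parents M v, all [pred S | ~~
      ((v \notin treatments S) && (parents M v :\ u \subset treatments S))] w].
  move=> fail; apply/existsP; apply: contraR fail.
  rewrite negb_exists => /forallP ok; apply/eqP.
  apply: (learned_graph_eq test_ok sep n_gt1) => u v uv.
  have := ok v; rewrite negb_exists_in => /forall_inP/(_ u uv).
  by rewrite -has_predC => /hasP[S Sw /= /negPn]; exists S.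
case: (ltngtP d 1) => [d_lt1|d_gt1|d1].
(* With [d = 0] there is no edge to miss, so no run fails. *)
- rewrite draws_probT; first by rewrite gerBl div1r invr_ge0 powR_ge0.
  move=> w; apply: contraT => /failE[v /exists_inP[u uv _]].
  have := le_d v; rewrite (cardsD1 u) uv; lia.
- apply: le_trans (@draws_prob_union R n d (repetitions n alpha d) _
    (fun v w => all (predC (isolates v)) w) _ _).
    rewrite lerD2l lerN2 -powR_natM //.
    apply: (@le_trans _ _ (\sum_(v : obs n) n%:R `^ (- alpha))).
      by apply: ler_sum => v _; apply: miss_isolates => //; lra.
    (* The outcome counts as well: the [n + 1] vertices are at most [n ^ 2] because [n > 1], whence
       the exponent [alpha - 2]. *)
    rewrite sumr_const card_option card_ord -[leLHS]mulr_natl ler_wpM2r ?powR_ge0 //.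
    by rewrite -natrX ler_nat; nia.
  move=> w /failE[v /exists_inP[u uv /allP miss]]; exists v; apply/allP => S Sw.
  apply: contra (miss S Sw) => /andP[-> ] /=; apply: subset_trans.
  exact: subsetDl.
(* With [d = 1] a treatment is included with probability 0, so almost every draw is empty; there is
   at least one draw, and each vertex has at most one parent, so an empty draw exposes every
   edge. *)
- have only0 : draws_prob R d (fun w : (repetitions n alpha d).-tuple {set 'I_n} =>
      all (predC (pred1 set0)) w) = 0.
    rewrite draws_prob_all.
    suff -> : \sum_(S : {set 'I_n} | S != set0) draw_prob R d S = 0.
      rewrite expr0n gtn_eqF // truncn_gt0 d1.
      by have := log2_ge1 R n_gt1; nra.
    apply: big1 => S /set0Pn[i iS].
    by rewrite /draw_prob (bigD1 i) //= iS d1 invr1 subrr mul0r.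
  apply: le_trans (@draws_prob_union R n d (repetitions n alpha d) unit
    (fun _ w => all (predC (pred1 set0)) w) _ _).
    by rewrite big1 // subr0 gerBl div1r invr_ge0 powR_ge0.
  move=> w /failE[v /exists_inP[u uv /allP miss]]; exists tt; apply/allP => S Sw.
  apply/negP => /eqP S0; have /negP := miss S Sw; apply; rewrite S0.
  have treat0 : treatments (set0 : {set 'I_n}) = set0 by apply: imset0.
  rewrite treat0 in_set0 /= subset0 -cards_eq0.
  by have := le_d v; rewrite (cardsD1 u) uv d1; lia.
Qed.

(** Only the [n] treatments enter the union bound, whence the exponent [alpha - 1]. For [d = 1]
    almost every draw is empty and contains no parent; for [d = 0] the convention on inverses makes
    it full, so it omits no treatment. *)
Lemma required_data_prob (alpha : R) : (1 < d)%N ->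
  1 - 1 / n%:R `^ (alpha - 1) <=
  draws_prob R d (fun w : (repetitions n alpha d).-tuple {set 'I_n} =>
    required_data M (learn_observable_graph test sys w)).
Proof.
move=> d_gt1; have [alpha_le1|alpha_gt1] := leP alpha 1.
  by apply: le_trans (trivial_bound _ _) (draws_prob_ge0 _ _ _); rewrite ?subr_le0.
case: (ltngtP n 1) n_gt0 => // [n_gt1|n1] _; last first.
  apply: le_trans (draws_prob_ge0 _ _ _).
  by rewrite n1 powR1 divr1 subrr.
apply: le_trans (@draws_prob_union R n d (repetitions n alpha d) _
  (fun i w => all (predC (isolates (Some i))) w) _ _).
  rewrite lerD2l lerN2.
  have -> : 1 / n%:R `^ (alpha - 1) = n%:R * n%:R `^ (- alpha).
    by rewrite -(powR_natM 1 alpha n_gt0) expr1.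
  apply: (@le_trans _ _ (\sum_(i < n) n%:R `^ (- alpha))).
    by apply: ler_sum => i _; apply: miss_isolates => //; lra.
  by rewrite sumr_const card_ord -[leLHS]mulr_natl.
move=> w; rewrite negb_forall => /existsP[i]; rewrite negb_exists => /forallP miss.
exists i; apply/allP => S Sw; apply: contra (miss S) => /andP[iS paS].
rewrite datasets_learn_observable_graph inE /= mem_map ?Sw; last exact: Some_inj.
by rewrite paS -mem_treatments.
Qed.

End Guarantees.

(** The free bound [c] serves twice: as the rounded logarithm for an arbitrary admissible system,
    and as the logarithm itself for the middle-layer system. *)
Lemma interventions_bound (R : realType) n d (alpha : R) (test : dependence_test n)
    (sys : seq {set 'I_n}) (w : (repetitions n alpha d).-tuple {set 'I_n}) (c : R) :
    0 < alpha -> (size sys)%:R <= 2 * c ->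
  (size (interventions (learn_observable_graph test sys w)))%:R
    <= 8 * alpha * d%:R * (log2 n%:R * c).
Proof.
move=> alpha_gt0 sz; rewrite size_interventions size_tuple natrM.
have -> : 8 * alpha * d%:R * (log2 n%:R * c) =
          (4 * alpha * d%:R * log2 n%:R) * (2 * c) by ring.
apply: ler_pM => //; rewrite truncn_le mulr_ge0 ?log2_ge0 //.
by rewrite mulr_ge0 // mulr_ge0 // ltW.
Qed.

Theorem theorem3 (R : realType) (n dmax : nat) (alpha : R)
    (M : gaussian_anm R n) (test : dependence_test n)
    (hn : (0 < n)%N) (halpha : 0 < alpha)
    (htest : test_correct M test)
    (hdmax : (max_degree (obs_graph M) <= dmax)%N) :
  let T := repetitions n alpha dmax in
  let run (sys : seq {set 'I_n}) (w : T.-tuple {set 'I_n}) :=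
    learn_observable_graph test sys w in
  let logn : R := log2 n%:R in
  (forall sys : seq {set 'I_n}, admissible R sys ->
    [/\ forall w : T.-tuple {set 'I_n},
          (size (interventions (run sys w)))%:R
            <= 8 * alpha * dmax%:R * (logn * (Num.ceil logn)%:~R),
        draws_prob R dmax
            (fun w => learned_graph (run sys w) == obs_graph M)
          >= 1 - 1 / n%:R `^ (alpha - 2)
      & (1 < dmax)%N ->
        draws_prob R dmax (fun w => required_data M (run sys w))
          >= 1 - 1 / n%:R `^ (alpha - 1)])
  /\ (exists sys : seq {set 'I_n}, admissible R sys /\
        forall w : T.-tuple {set 'I_n},
          (size (interventions (run sys w)))%:R
            <= 8 * alpha * dmax%:R * logn ^+ 2).
Proof.
move=> T run logn; split.
  move=> sys [sep sz]; split=> [w||d_gt1].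
  - exact: interventions_bound.
  - exact: learned_graph_prob.
  - exact: required_data_prob.
(* The middle-layer system has at most [2 * log n] sets without rounding, which gives the square of
   the logarithm. *)
have [sys sep sz] := strongly_separating_exists hn.
have ln2_gt0 : 0 < ln 2 :> R by apply: ln_gt0; lra.
have le_logn : (size sys)%:R <= 2 * logn.
  have : ln (2 ^+ size sys) <= ln (n%:R ^+ 2) :> R.
    by rewrite ler_ln ?posrE ?exprn_gt0 ?ltr0n // -!natrX ler_nat.
  rewrite !lnXn ?ltr0n // -[X in X <= _]mulr_natl -[X in _ <= X]mulr_natl => le_ln.
  by rewrite /logn /log2 mulrA ler_pdivlMr.
exists sys; split=> [|w]; last by rewrite expr2; apply: interventions_bound.
by split=> //; apply: le_trans le_logn _; rewrite ler_wpM2l // ceil_ge.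
Qed.
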